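(* Let $p$ be the mesh pattern $(12,R)$ with $R=\{(0,1),(0,2),(1,0),(1,1),(2,0),(2,2)\}$, let $E(t,u)=\sum_{n\ge0}t^n\sum_{\sigma\in K_n}u^{p(\sigma)}$, and let $P(t)=\sum_{n\ge0}|K_n(p)|t^n$. Then $$P(t)=\left(t+\frac{1}{1+t}-\frac{t^2A(t)^2}{(1+t)\big(1+t+tA(t)\big)}\right)A(t),$$ $$E(t,u)=\left(1+\frac{t^2(1-u)}{1+t}\left(1-\frac{A(t)^2}{1+t\big(1+u+ut+(1-u)A(t)\big)}\right)\right)A(t).$$ The initial terms of $E(t,u)$ are $1+t+2t^4+14t^5+(86+4u)t^6+(624+20u+2u^2)t^7+(5096+136u+10u^2)t^8+\cdots$.
   Context: A permutation $\sigma=\sigma_1\cdots\sigma_n$ of $\{1,\dots,n\}$ is a king permutation if $|\sigma_{i+1}-\sigma_i|>1$ for all $1\le i\le n-1$. $K_n$ is the set of king permutations of length $n$ ($K_0$ = the empty permutation, $K_1=\{1\}$) and $A(t)=\sum_{n\ge0}|K_n|t^n$ (known to equal $\sum_{n\ge0}n!\,t^n(1-t)^n/(1+t)^n$). For a mesh pattern $p=(12,R)$ with $R\subseteq\{0,1,2\}^2$, an occurrence of $p$ in $\sigma\in S_n$ is a pair of positions $i_1<i_2$ with $\sigma_{i_1}<\sigma_{i_2}$ such that for every $(x,y)\in R$ there is no position $m$ with $i_x<m<i_{x+1}$ and $v_y<\sigma_m<v_{y+1}$, where $i_0=0$, $i_3=n+1$, $v_0=0$, $v_1=\sigma_{i_1}$,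 $v_2=\sigma_{i_2}$, $v_3=n+1$ (first coordinate of a box indexes positions, second values). $p(\sigma)$ is the number of occurrences of $p$ in $\sigma$; $K_n(p)$ is the set of king $n$-permutations with $p(\sigma)=0$. *)

(* Defs.v *)
From HB Require Import structures.
From mathcomp Require Import all_boot all_order all_fingroup all_algebra.
From mathcomp Require Import boolp.

Set Implicit Arguments.
Unset Strict Implicit.
Unset Printing Implicit Defensive.

Import GRing.Theory.
Local Open Scope ring_scope.

(** * The ring R[[t]] of formal power series *)

Record fps (R : comUnitRingType) := Fps { fcoef : nat -> R }.

Section FormalPowerSeries.
Variable R : comUnitRingType.
Implicit Types f g h : fps R.

Lemma fpsP f g : (forall n, fcoef f n = fcoef g n) -> f = g.
Proof. by case: f g => [f] [g] /= /funext ->. Qed.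

HB.instance Definition _ := gen_eqMixin (fps R).
HB.instance Definition _ := gen_choiceMixin (fps R).

Definition fpsC (c : R) : fps R := Fps (fun n => if n == 0%N then c else 0).
Definition fpsX : fps R := Fps (fun n => (n == 1%N)%:R).

Definition fps_opp f : fps R := Fps (fun n => - fcoef f n).
Definition fps_add f g : fps R := Fps (fun n => fcoef f n + fcoef g n).
Definition fps_mul f g : fps R :=
  Fps (fun n => \sum_(i < n.+1) fcoef f i * fcoef g (n - i)).

Fact fps_addA : associative fps_add.
Proof. by move=> f g h; apply: fpsP => n /=; rewrite addrA. Qed.

Fact fps_addC : commutative fps_add.
Proof. by move=> f g; apply: fpsP => n /=; rewrite addrC. Qed.

Fact fps_add0 : left_id (fpsC 0) fps_add.
Proof. by move=> f; apply: fpsP => n /=; rewrite if_same add0r. Qed.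

Fact fps_addN : left_inverse (fpsC 0) fps_opp fps_add.
Proof. by move=> f; apply: fpsP => n /=; rewrite if_same addNr. Qed.

HB.instance Definition _ :=
  GRing.isZmodule.Build (fps R) fps_addA fps_addC fps_add0 fps_addN.

Definition fps_trunc N f : {poly R} := \poly_(i < N) fcoef f i.

Lemma fcoef_mul_trunc N f g n : (n < N)%N ->
  fcoef (fps_mul f g) n = (fps_trunc N f * fps_trunc N g)`_n.
Proof.
move=> ltnN; rewrite coefM /=; apply: eq_bigr => i _.
have lein : (i <= n)%N by rewrite -ltnS.
by rewrite !coef_poly (leq_ltn_trans lein ltnN) (leq_ltn_trans (leq_subr i n) ltnN).
Qed.

Fact fps_mulC : commutative fps_mul.
Proof.
by move=> f g; apply: fpsP => n; rewrite !(@fcoef_mul_trunc n.+1) // mulrC.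
Qed.

Fact fps_mulA : associative fps_mul.
Proof.
have trM f g n k : (k < n)%N ->
  (fps_trunc n (fps_mul f g))`_k = (fps_trunc n f * fps_trunc n g)`_k.
  by move=> ltkn; rewrite coef_poly ltkn (fcoef_mul_trunc _ _ ltkn).
move=> f g h; apply: fpsP => n; rewrite !(@fcoef_mul_trunc n.+1) //.
transitivity ((fps_trunc n.+1 f * (fps_trunc n.+1 g * fps_trunc n.+1 h))`_n).
  by rewrite !(coefM (fps_trunc n.+1 f)); apply: eq_bigr => i _;
     rewrite trM // ltnS leq_subr.
by rewrite mulrA ![RHS]coefM coefM; apply: eq_bigr => i _; rewrite trM.
Qed.

Fact fps_mul1 : left_id (fpsC 1) fps_mul.
Proof.
move=> f; apply: fpsP => n /=; rewrite big_ord_recl /= mul1r subn0.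
by rewrite big1 ?addr0 // => i _; rewrite mul0r.
Qed.

Fact fps_mulDl : left_distributive fps_mul fps_add.
Proof.
move=> f g h; apply: fpsP => n /=; rewrite -big_split /=.
by apply: eq_bigr => i _; rewrite mulrDl.
Qed.

Fact fps_1neq0 : fpsC 1 != 0.
Proof.
by apply/eqP => /(congr1 (fun f => fcoef f 0)) /eqP; rewrite /= oner_eq0.
Qed.

HB.instance Definition _ := GRing.Zmodule_isComNzRing.Build (fps R)
  fps_mulA fps_mulC fps_mul1 fps_mulDl fps_1neq0.

Definition fps_unit : pred (fps R) := fun f => fcoef f 0 \is a GRing.unit.

(* The first n coefficients of 1/f, solved one after the other from
   f * (1/f) = 1. *)
Fixpoint fps_inv_coefs f n : seq R :=
  if n is m.+1 then
    let s := fps_inv_coefs f m in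
    rcons s ((fcoef f 0)^-1
             * ((m == 0%N)%:R - \sum_(i < m) fcoef f (m - i) * s`_i))
  else [::].

Definition fps_inv f : fps R :=
  if fps_unit f then Fps (fun n => (fps_inv_coefs f n.+1)`_n) else f.

Lemma size_fps_inv_coefs f n : size (fps_inv_coefs f n) = n.
Proof. by elim: n => //= n IHn; rewrite size_rcons IHn. Qed.

Lemma nth_fps_inv_coefs f n i : (i < n)%N ->
  (fps_inv_coefs f n)`_i = (fps_inv_coefs f i.+1)`_i.
Proof.
elim: n => // n IHn; rewrite ltnS leq_eqVlt => /predU1P[-> // | ltin].
by rewrite [LHS]/= nth_rcons size_fps_inv_coefs ltin IHn.
Qed.

Fact fps_mulVf : {in fps_unit, left_inverse 1 fps_inv *%R}.
Proof.
move=> f Uf; apply: fpsP => n; rewrite -[RHS]/(if n == 0%N then 1 else 0).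
rewrite /fps_inv [fps_unit f]Uf.
change (\sum_(i < n.+1) (fps_inv_coefs f i.+1)`_i * fcoef f (n - i)
        = if n == 0%N then 1 else 0).
rewrite big_ord_recr /= subnn nth_rcons size_fps_inv_coefs ltnn eqxx.
rewrite [_^-1 * _]mulrC mulrVK //.
rewrite (eq_bigr (fun i : 'I_n => fcoef f (n - i) * (fps_inv_coefs f n)`_i)).
  by rewrite addrC subrK; case: eqP.
by move=> i _; rewrite (nth_fps_inv_coefs f (ltn_ord i)) mulrC.
Qed.

Fact fps_unitPl f g : g * f = 1 -> fps_unit f.
Proof.
move/(congr1 (fun h => fcoef h 0)); rewrite /= big_ord1 subnn => gf1.
by apply/unitrPr; exists (fcoef g 0); rewrite mulrC.
Qed.

Fact fps_inv_out : {in [predC fps_unit], fps_inv =1 id}.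
Proof. by move=> f; move/negbTE=> nUf; rewrite /fps_inv [fps_unit f]nUf. Qed.

HB.instance Definition _ := GRing.ComNzRing_hasMulInverse.Build (fps R)
  fps_mulVf fps_unitPl fps_inv_out.

End FormalPowerSeries.

(** * King permutations and mesh patterns with underlying permutation 12 *)

(* Permutations act on {0, ..., n-1}: sigma_i is (s (i-1)) + 1. *)
Definition king n : {set 'S_n} :=
  [set s : 'S_n | [forall i : 'I_n, forall j : 'I_n,
     (j == i.+1 :> nat) ==> (1 < `|s j - s i|)%N]].

Section MeshPattern12.
Variables (R : {set 'I_3 * 'I_3}) (n : nat).
Implicit Types (s : 'S_n) (i j m : 'I_n).

(* i_0 < i_1 < i_2 < i_3 and v_0 < v_1 < v_2 < v_3, with 1-based positions and
   values as in the definition of an occurrence. *)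
Definition mesh_pos i j : seq nat := [:: 0; i.+1; j.+1; n.+1]%N.
Definition mesh_val s i j : seq nat := [:: 0; (s i).+1; (s j).+1; n.+1]%N.

Definition in_box s i j (b : 'I_3 * 'I_3) m : bool :=
  (nth 0 (mesh_pos i j) b.1 < m.+1 < nth 0 (mesh_pos i j) b.1.+1)%N &&
  (nth 0 (mesh_val s i j) b.2 < (s m).+1 < nth 0 (mesh_val s i j) b.2.+1)%N.

Definition mesh12_occ s : {set 'I_n * 'I_n} :=
  [set ij : 'I_n * 'I_n |
     [&& (ij.1 < ij.2)%N, (s ij.1 < s ij.2)%N &
         [forall b in R, ~~ [exists m, in_box s ij.1 ij.2 b m]]]].

Definition mesh12_count s : nat := #|mesh12_occ s|.

Definition king_avoid : {set 'S_n} := [set s in king n | mesh12_count s == 0%N].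

End MeshPattern12.

Definition pat : {set 'I_3 * 'I_3} :=
  [set b | (val b.1, val b.2) \in
     [:: (0, 1); (0, 2); (1, 0); (1, 1); (2, 0); (2, 2)]%N].

(** * Generating functions *)

Definition kingA (T : comUnitRingType) : fps T := Fps (fun n => #|king n|%:R).

Definition avoidP (R : {set 'I_3 * 'I_3}) : fps int :=
  Fps (fun n => #|king_avoid R n|%:R).

(* The variable u is the indeterminate 'X of the coefficient ring Z[u]. *)
Definition distE (R : {set 'I_3 * 'I_3}) : fps {poly int} :=
  Fps (fun n => \sum_(s in king n) 'X^(mesh12_count R s)).

(* Main.v *)
Require Import Defs.
From HB Require Import structures.
From mathcomp Require Import all_boot all_order all_fingroup all_algebra.
From mathcomp Require Import zify ring.

Set Implicit Arguments.
Unset Strict Implicit.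
Unset Printing Implicit Defensive.

Import GRing.Theory.
Local Open Scope nat_scope.

(** An occurrence of the pattern in [s] is a decomposition
    [s = a (+) 1 (+) (b (-) 1 (-) c)] into direct and skew sums.  In a king
    permutation the last summand [r = b (-) 1 (-) c] has more than one entry, so
    it is the last direct-sum component of [s]: at most one decomposition
    [s = a (+) 1 (+) r] contributes, and the number of occurrences is the number
    of singleton skew components of [r].  Reversing [r], let [F] count king
    permutations by their singleton direct components (variable [u]), [G] those
    among them that do not end with their maximum, and [B], [S] the king
    permutations not ending with their maximum, resp. not starting with their
    minimum.  Cutting off a last or first entry, and cutting at a singleton
    component (with [u^c - 1 = sum_(k < c) (u - 1) u^k]), gives
      [A = (1 + t) B = (1 + t) S],  [F = (1 + u t) G],
      [F - A = (u - 1) t G S],  [E - A = t B (F - A - (u - 1) t)],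
    which determines [E]; [P] is the case [u = 0].  The initial terms are
    computed by enumerating king permutations. *)

(** * Words and their singleton components *)

Definition far (x y : nat) := (x.+1 < y) || (y.+1 < x).
Definition king_word (w : seq nat) := sorted far w.

(* For a permutation word [w], this says [w = a (+) 1 (+) b] with [size a = i]. *)
Definition single (w : seq nat) i :=
  all (fun x => x < nth 0 w i) (take i w) &&
  all (fun x => nth 0 w i < x) (drop i.+1 w).

Definition singles w := count (single w) (iota 0 (size w)).

(** Reversing the suffix turns its singleton skew components into direct ones. Since [single] only
    compares entries, the suffix need not be standardised. *)
Definition occs w :=
  sumn [seq singles (rev (drop i.+1 w)) | i <- iota 0 (size w) & single w i].

Definition perm_words n := permutations (iota 0 n).

Definition shift k (w : seq nat) := [seq k + x | x <- w].
(* The direct sum [a (+) 1 (+) b], for [a] and [b] permutation words. *)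
Definition glue a b : seq nat := a ++ size a :: shift (size a).+1 b.
(** Meant for [single w i] with [w] a permutation word: the suffix then only has entries above [i],
    so the subtraction never truncates and standardises it. *)
Definition tail_word i (w : seq nat) := [seq x - i.+1 | x <- drop i.+1 w].

(* [king_word (a (+) 1)] and [king_word (1 (+) b)]: for king words, [a] does not
   end with its maximum and [b] does not start with its minimum. *)
Definition king_end a := king_word (rcons a (size a)).
Definition king_start b := king_word (0 :: shift 1 b).

Lemma hasN_filter (T : Type) (p : pred T) s : ~~ has p s -> filter p s = [::].
Proof. by elim: s => //= x s IHs; case: (p x). Qed.

Lemma shiftK k w : [seq x - k | x <- shift k w] = w.
Proof. by rewrite -map_comp -[RHS]map_id; apply: eq_map => x /=; lia. Qed.

Lemma perm_wordP n w : reflect [/\ size w = n, uniq w & all (fun x => x < n) w]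
  (w \in perm_words n).
Proof.
rewrite mem_permutations; apply: (iffP idP) => [pw | [sw uw /allP aw]].
  split; first by rewrite (perm_size pw) size_iota.
    by rewrite (perm_uniq pw) iota_uniq.
  by apply/allP => x; rewrite (perm_mem pw) mem_iota.
apply: uniq_perm => //; first exact: iota_uniq.
apply: (uniq_min_size uw _ _).2; last by rewrite size_iota sw.
by move=> x /aw; rewrite mem_iota.
Qed.

Lemma size_perm_word n w : w \in perm_words n -> size w = n.
Proof. by case/perm_wordP. Qed.

Lemma size_glue a b : size (glue a b) = (size a + size b).+1.
Proof. by rewrite size_cat /= size_map addnS. Qed.

Lemma take_glue a b : take (size a) (glue a b) = a.
Proof. by rewrite take_size_cat. Qed.

Lemma drop_glue a b : drop (size a).+1 (glue a b) = shift (size a).+1 b.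
Proof. by rewrite drop_cat ltnNge leqnSn /= subSnn /= drop0. Qed.

Lemma tail_glue a b : tail_word (size a) (glue a b) = b.
Proof. by rewrite /tail_word drop_glue shiftK. Qed.

Lemma nth_glue a b : nth 0 (glue a b) (size a) = size a.
Proof. by rewrite nth_cat ltnn subnn. Qed.

Lemma glue_perm i j a b : a \in perm_words i -> b \in perm_words j ->
  glue a b \in perm_words (i + j).+1.
Proof.
move=> /perm_wordP[sa ua /allP la] /perm_wordP[sb ub /allP lb].
apply/perm_wordP; split; first by rewrite size_glue sa sb.
  rewrite cat_uniq ua /= map_inj_uniq => [|x y]; last by lia.
  rewrite ub andbT sa; apply/andP; split.
    rewrite negb_or; apply/andP; split; first by apply/negP => /la; lia.
    by apply/hasPn => _ /mapP[x _ ->]; apply/negP => /la; lia.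
  by apply/negP => /mapP[x _]; lia.
rewrite all_cat /= sa; apply/and3P; split; last 2 first; first by lia.
  by apply/allP => _ /mapP[x /lb xj ->]; lia.
by apply/allP => x /la; lia.
Qed.

Lemma single_glue_mid i a b : a \in perm_words i -> single (glue a b) (size a).
Proof.
move=> /perm_wordP[sa _ /allP la].
rewrite /single nth_glue take_glue drop_glue; apply/andP; split.
  by apply/allP => x /la; rewrite sa.
by apply/allP => _ /mapP[x _ ->]; lia.
Qed.

(* Counting the entries smaller than the single entry shows that it is a fixed
   point. *)
Lemma single_decomp n w i : w \in perm_words n -> i < n -> single w i ->
  [/\ take i w \in perm_words i, tail_word i w \in perm_words (n - i.+1)
    & w = glue (take i w) (tail_word i w)].
Proof.
move=> pw lin /andP[ltv gtv]; have /perm_wordP[sw uw aw] := pw.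
move: pw; rewrite mem_permutations => pw.
set v := nth 0 w i in ltv gtv *.
have Ew : w = take i w ++ v :: drop i.+1 w.
  by rewrite -drop_nth ?sw // cat_take_drop.
have lvn : v < n by apply: (allP aw); rewrite mem_nth ?sw.
have szt : size (take i w) = i by rewrite size_take sw lin.
have pt : perm_eq (take i w) (iota 0 v).
  have -> : take i w = [seq x <- w | x < v].
    rewrite [in RHS]Ew filter_cat /= ltnn.
    rewrite (all_filterP ltv) (hasN_filter (s := drop _ _)) ?cats0 //.
    by apply/hasPn => x /(allP gtv); lia.
  apply: perm_trans (perm_filter _ pw) _.
  apply: uniq_perm; rewrite ?filter_uniq ?iota_uniq // => x.
  by rewrite mem_filter !mem_iota; lia.
have vi : v = i by have := perm_size pt; rewrite szt size_iota.
have pd : perm_eq (drop i.+1 w) (iota i.+1 (n - i.+1)).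
  have -> : drop i.+1 w = [seq x <- w | v < x].
    rewrite [in RHS]Ew filter_cat /= ltnn.
    rewrite (all_filterP gtv) hasN_filter //.
    by apply/hasPn => x /(allP ltv); lia.
  apply: perm_trans (perm_filter _ pw) _.
  apply: uniq_perm; rewrite ?filter_uniq ?iota_uniq // => x.
  by rewrite mem_filter !mem_iota; lia.
split; first by rewrite mem_permutations -{2}vi.
  rewrite mem_permutations.
  apply: perm_trans (perm_map _ pd) _.
  rewrite -[X in iota X _]addn0 iotaDl.
  by have := shiftK i.+1 (iota 0 (n - i.+1)); rewrite /shift => ->.
rewrite /glue szt {1}Ew vi; congr (_ ++ _ :: _).
rewrite /shift /tail_word -map_comp -[LHS]map_id; apply/eq_in_map => x.
by rewrite (perm_mem pd) mem_iota /=; lia.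
Qed.

Lemma singleP w i : i < size w ->
  reflect (forall m, m < size w -> (m < i -> nth 0 w m < nth 0 w i) /\
                                   (i < m -> nth 0 w i < nth 0 w m))
          (single w i).
Proof.
move=> liw; apply: (iffP andP) => [[/(all_nthP 0) tk /(all_nthP 0) dr] m lm|H].
  split=> lmi.
    by have := tk m; rewrite size_take liw nth_take //; apply.
  have := dr (m - i.+1); rewrite size_drop nth_drop subnKC //; apply.
  by rewrite ltn_sub2r //; lia.
split; apply/(all_nthP 0) => m.
  by rewrite size_take liw => lm; rewrite nth_take //; apply: (H m _).1; lia.
rewrite size_drop nth_drop => lm; apply: (H _ _).2; lia.
Qed.

(** All letters after [a] in [glue a b] exceed those of [a], so they only add conditions that hold
    anyway. *)
Lemma single_glue_left a b j : all (fun x => x < size a) a -> j < size a ->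
  single (glue a b) j = single a j.
Proof.
move=> /allP la lj; rewrite /single /glue nth_cat lj take_cat lj drop_cat.
congr andb; have lv : nth 0 a j < size a by apply: la; rewrite mem_nth.
have big : all (fun x => nth 0 a j < x) (size a :: shift (size a).+1 b).
  by rewrite /= lv /=; apply/allP => _ /mapP[x _ ->]; lia.
case: ifP => [_|]; first by rewrite all_cat big andbT.
move=> nl; have -> : j.+1 = size a by lia.
by rewrite subnn drop0 big drop_size.
Qed.

Lemma count_single_glue i a b : a \in perm_words i ->
  count (single (glue a b)) (iota 0 i) = singles a.
Proof.
move=> /perm_wordP[<- _ la]; apply: eq_in_count => j.
by rewrite mem_iota => /andP[_ lj]; apply: single_glue_left.
Qed.

Lemma single_shift k w i : i < size w -> single (shift k w) i = single w i.
Proof.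
move=> liw; rewrite /single /shift -map_take -map_drop !all_map (nth_map 0) //.
by congr andb; apply: eq_all => x /=; rewrite ltn_add2l.
Qed.

Lemma singles_shift k w : singles (shift k w) = singles w.
Proof.
rewrite /singles size_map; apply: eq_in_count => i.
by rewrite mem_iota; apply: single_shift.
Qed.

(** A singleton direct component is above everything to its left and below everything to its right;
    a singleton skew component is the opposite. Two such entries contradict each other, and if they
    coincide, any further entry gives the contradiction. *)
Lemma single_rev_unique w k l : k < size w -> l < size w ->
  single w k -> single (rev w) l -> size w = 1.
Proof.
move=> lk ll /singleP-/(_ lk) Hk /singleP; rewrite size_rev => /(_ ll) Hl.
(* The condition on [l] is read in [w] itself, at the mirror position [size w - l.+1]. *)
have Hl' m : m < size w ->
    (size w - l.+1 < m -> nth 0 w m < nth 0 w (size w - l.+1)) /\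
    (m < size w - l.+1 -> nth 0 w (size w - l.+1) < nth 0 w m).
  move=> lm; have := Hl (size w - m.+1); rewrite !nth_rev //; last by lia.
  by have -> : size w - (size w - m.+1).+1 = m; lia.
set l' := size w - l.+1 in Hl'; have ll' : l' < size w by rewrite /l'; lia.
case: (ltngtP k l') => [kl|kl|kl].
- by have := (Hk _ ll').2 kl; have := (Hl' _ lk).2 kl; lia.
- by have := (Hk _ ll').1 kl; have := (Hl' _ lk).1 kl; lia.
apply/eqP; rewrite eqn_leq; apply/andP; split; last by lia.
rewrite leqNgt; apply/negP => gt1.
have [m lm mk] : exists2 m, m < size w & m != k.
  by case: (posnP k) => k0; [exists 1 | exists 0]; lia.
have {}Hl' := Hl' m lm; have {}Hk := Hk m lm; rewrite -kl in Hl'.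
by case: (ltngtP m k) mk Hk Hl' => // mk _ [H1 H2] [H3 H4];
  [have := H1 isT; have := H4 isT | have := H2 isT; have := H3 isT]; lia.
Qed.

Lemma farC x y : far x y = far y x.
Proof. by rewrite /far orbC. Qed.

Lemma king_rev w : king_word (rev w) = king_word w.
Proof. by rewrite /king_word rev_sorted; apply: eq_sorted => x y; rewrite farC. Qed.

Lemma king_shift k w : king_word (shift k w) = king_word w.
Proof.
rewrite /king_word sorted_map; apply: eq_sorted => x y /=.
by rewrite /far /=; lia.
Qed.

(** Being king is a condition on neighbours, so it splits at the middle letter, which belongs to
    both halves; the right half is translated down by [size a]. *)
Lemma king_glue a b : king_word (glue a b) = king_end a && king_start b.
Proof.
rewrite /king_start -(king_shift (size a) (0 :: _)) /king_end /king_word /glue.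
have -> : shift (size a) (0 :: shift 1 b) = size a :: shift (size a).+1 b.
  rewrite /shift /= addn0 -map_comp; congr (_ :: _).
  by apply: eq_map => x /=; lia.
case: a => [|x a] /=; first by [].
by rewrite cat_path rcons_path /= andbA.
Qed.

Lemma king_start_tail b : king_start b -> king_word b.
Proof. by rewrite /king_start => /path_sorted; rewrite -(king_shift 1). Qed.

(** After the shift the first letter is at least 2, hence far from the prepended 0. The default
    value of [head] makes the hypothesis exclude the empty word. *)
Lemma king_start_head b : head 0 b != 0 -> king_start b = king_word b.
Proof.
rewrite -(king_shift 1) /king_start /king_word.
by case: b => //= x b x0; rewrite /far; case: x x0.
Qed.

Lemma king_start_0 b : king_start (0 :: b) = false.
Proof. by []. Qed.

Lemma king_end_max a : king_end (rcons a (size a)) = false.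
Proof.
rewrite /king_end /king_word size_rcons -!cats1 -catA /=.
case: a => [|x a] //=; rewrite cat_path /= /far; lia.
Qed.

Lemma king_end_last n w : w \in perm_words n.+1 -> nth 0 w n != n ->
  king_end w = king_word w.
Proof.
case/perm_wordP => sw _ aw nx; rewrite /king_end /king_word sw.
case: w sw aw nx => // x w [sw] /= aw nx; rewrite rcons_path.
have lw : last x w < n.+1.
  exact: (allP (aw : all _ (x :: w))) (mem_last x w).
have: last x w != n by rewrite (last_nth 0) sw.
move: (last x w) lw => y ly yn; rewrite /far; case: path => //=.
by have [] := ltngtP y n; lia.
Qed.

Lemma perm_words0 : perm_words 0 = [:: [::]].
Proof. by []. Qed.

Lemma single_head0 n w : w \in perm_words n -> head 0 w = 0 -> 0 < n ->
  single w 0.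
Proof.
case/perm_wordP; case: w => [<- //|x w] /= _ /andP[xw _] _ x0 _.
rewrite /single /= drop0; apply/allP => y yw; rewrite x0 lt0n.
by apply/eqP => y0; move: xw; rewrite x0 -y0 yw.
Qed.

Local Open Scope ring_scope.

(** * Generating functions over words *)

Section GeneratingFunctions.
Variable T : comUnitRingType.
Implicit Types (f g : seq nat -> T) (h : fps T) (u : T).

Lemma fcoefM h1 h2 n :
  fcoef (h1 * h2) n = \sum_(i < n.+1) fcoef h1 i * fcoef h2 (n - i).
Proof. by []. Qed.

Lemma fcoefD h1 h2 n : fcoef (h1 + h2) n = fcoef h1 n + fcoef h2 n.
Proof. by []. Qed.

Lemma fcoefXM h n : fcoef (fpsX T * h) n = if n is m.+1 then fcoef h m else 0.
Proof.
rewrite fcoefM; case: n => [|n]; first by rewrite big_ord1 mul0r.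
rewrite big_ord_recl mul0r add0r big_ord_recl /= mul1r subSS subn0.
by rewrite big1 ?addr0 // => i _; rewrite mul0r.
Qed.

Lemma fcoefCM c h n : fcoef (fpsC c * h) n = c * fcoef h n.
Proof.
rewrite fcoefM big_ord_recl /= subn0 big1 ?addr0 // => i _.
by rewrite mul0r.
Qed.

Definition gf f : fps T := Fps (fun n => \sum_(w <- perm_words n) f w).

Lemma eq_gf f g : (forall n, {in perm_words n, f =1 g}) -> gf f = gf g.
Proof. by move=> fg; apply: fpsP => n; apply: eq_big_seq => w /fg. Qed.

Lemma gfD f g : gf (fun w => f w + g w) = gf f + gf g.
Proof. by apply: fpsP => n; rewrite fcoefD -big_split. Qed.

Lemma gfZ c f : gf (fun w => c * f w) = fpsC c * gf f.
Proof. by apply: fpsP => n; rewrite fcoefCM /= mulr_sumr. Qed.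

Lemma gf_rev f : gf (fun w => f (rev w)) = gf f.
Proof.
apply: fpsP => n /=; rewrite -(big_map rev xpredT f).
apply: perm_big; apply: uniq_perm; rewrite ?permutations_uniq //.
  by rewrite (map_inj_uniq (can_inj revK)) permutations_uniq.
move=> w; rewrite -{1}[w]revK (mem_map (can_inj revK)) !mem_permutations.
by rewrite perm_rev.
Qed.

Lemma gf_nil : gf (fun w => (w == [::])%:R) = 1.
Proof.
apply: fpsP => n; rewrite -[RHS]/(if n == 0%N then 1 else 0).
case: n => [|n] /=; first by rewrite perm_words0 big_seq1.
by rewrite big_seq big1 // => w /size_perm_word; case: w.
Qed.

Lemma gf_word0 : gf (fun w => (w == [:: 0%N])%:R) = fpsX T.
Proof.
apply: fpsP => -[|[|n]] /=; first by rewrite perm_words0 big_seq1.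
  by rewrite /perm_words /= big_seq1.
by rewrite big_seq big1 // => w /size_perm_word;
  case: w => // x [|y w] // _; rewrite eqseq_cons andbF.
Qed.

(* The sum over all decompositions [w = a (+) 1 (+) b]. *)
Definition conv f g w : T :=
  \sum_(i < size w | single w i) f (take i w) * g (tail_word i w).

(** For fixed [i], [glue] is a bijection from pairs of permutation words of sizes [i] and [n - i]
    onto the words of size [n.+1] with a singleton component at [i]; the middle letter accounts for
    the factor [fpsX T]. *)
Lemma gf_conv f g : gf (conv f g) = fpsX T * (gf f * gf g).
Proof.
apply: fpsP => n; rewrite fcoefXM; case: n => [|n].
  by rewrite /= perm_words0 big_seq1 /conv big_ord0.
rewrite fcoefM /= /conv.
transitivity (\sum_(w <- perm_words n.+1) \sum_(i < n.+1 | single w i)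
    f (take i w) * g (tail_word i w)).
  by apply: eq_big_seq => w /size_perm_word ->.
rewrite (exchange_big_dep predT) //=; apply: eq_bigr => i _.
rewrite -big_filter mulr_suml.
under [RHS]eq_bigr do rewrite mulr_sumr.
have Ei a : a \in perm_words i -> size a = i by exact: size_perm_word.
rewrite -(big_allpairs (r1 := perm_words i) (r2 := perm_words (n - i))
  (F := fun p => f p.1 * g p.2)).
transitivity (\sum_(w <- [seq glue p.1 p.2 | p <-
    [seq (a, b) | a <- perm_words i, b <- perm_words (n - i)]])
    f (take i w) * g (tail_word i w)); last first.
  rewrite big_map; apply: eq_big_seq => _ /allpairsP[[a b] /= [/Ei sa _ ->]] /=.
  by rewrite -sa take_glue tail_glue.
apply: perm_big; apply: uniq_perm.
- by rewrite filter_uniq // permutations_uniq.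
- rewrite map_inj_in_uniq.
    by apply: allpairs_uniq; rewrite ?permutations_uniq //; case=> ? ? [].
  move=> _ _ /allpairsP[[a b] /= [/Ei sa _ ->]]
    /allpairsP[[a' b'] /= [/Ei sa' _ ->]] /= E.
  congr pair; first by rewrite -(take_glue a b) E sa -sa' take_glue.
  by rewrite -(tail_glue a b) E sa -sa' tail_glue.
move=> w; rewrite mem_filter; apply/andP/mapP => [[sw pw]|[p]].
  have [pa pb E] := single_decomp pw (ltn_ord i) sw.
  exists (take i w, tail_word i w) => //.
  by apply/allpairsP; exists (take i w, tail_word i w); rewrite -subSS.
case/allpairsP=> -[a b] /= [pa pb ->] -> /=; rewrite -{1}(Ei _ pa).
split; first exact: single_glue_mid pa.
by have := glue_perm pa pb; rewrite subnKC // -ltnS.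
Qed.

Lemma gf_conv_r f : gf (conv f (fun w => (w == [::])%:R)) = fpsX T * gf f.
Proof. by rewrite gf_conv gf_nil mulr1. Qed.

Lemma gf_conv_l f : gf (conv (fun w => (w == [::])%:R) f) = fpsX T * gf f.
Proof. by rewrite gf_conv gf_nil mul1r. Qed.

(** An empty right summand puts the singleton component in last position, and a last entry is such a
    component exactly when it is the maximum. *)
Lemma conv_nil_r n f w : w \in perm_words n.+1 ->
  conv f (fun v => (v == [::])%:R) w = (nth 0%N w n == n)%:R * f (take n w).
Proof.
move=> pw; have sw := size_perm_word pw; rewrite /conv sw big_mkcond big_ord_recr /=.
rewrite big1 ?add0r => [|i _]; last first.
  case: ifP => // _; rewrite [_ == _](_ : _ = false) ?mulr0 //.
  by rewrite -size_eq0 size_map size_drop sw; have := ltn_ord i; lia.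
have -> : tail_word n w = [::] by rewrite /tail_word drop_oversize ?sw.
rewrite eqxx mulr1.
have -> : single w n = (nth 0%N w n == n).
  apply/idP/eqP => [sn | E].
    have [pa _ ->] := single_decomp pw (ltnSn n) sn.
    by rewrite -{3}(size_perm_word pa) nth_glue (size_perm_word pa).
  rewrite /single E (drop_oversize (n := n.+1)) ?sw // andbT.
  apply/(all_nthP 0%N) => i; rewrite size_takel ?sw // => li; rewrite nth_take //.
  case/perm_wordP: pw => _ uw aw.
  have := all_nthP 0%N aw i; rewrite sw ltnS => /(_ (ltnW li)).
  rewrite ltnS leq_eqVlt => /orP[/eqP Ei|//].
  have : nth 0%N w i == nth 0%N w n by rewrite Ei E.
  rewrite nth_uniq ?sw ?ltnS // => [/eqP Ein|]; last exact: ltnW.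
  by rewrite Ein ltnn in li.
by case: eqP => _; rewrite ?mul1r ?mul0r.
Qed.

Lemma conv_nil_l n f w : w \in perm_words n.+1 ->
  conv (fun v => (v == [::])%:R) f w = (head 0%N w == 0%N)%:R * f (tail_word 0 w).
Proof.
move=> pw; have sw := size_perm_word pw; rewrite /conv sw big_mkcond big_ord_recl /=.
rewrite big1 ?addr0 => [|i _]; last first.
  case: ifP => // _; rewrite [_ == _](_ : _ = false) ?mul0r //.
  by rewrite -size_eq0 size_takel // sw; have := ltn_ord i; rewrite /bump; lia.
rewrite take0 eqxx mul1r.
have -> : single w 0 = (head 0%N w == 0%N).
  apply/idP/eqP => [sn | E]; last exact: (single_head0 pw).
  by have [_ _ ->] := single_decomp pw (ltn0Sn n) sn; rewrite take0.
by case: eqP => _; rewrite ?mul1r ?mul0r.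
Qed.

(** These are, in order, the series [A], [S], [F], [G] and [E] of the overview; [B] is
    [singles_end_gf 1]. *)
Definition king_gf := gf (fun w => (king_word w)%:R).
Definition king_start_gf := gf (fun w => (king_start w)%:R).
Definition singles_gf u := gf (fun w => (king_word w)%:R * u ^+ singles w).
Definition singles_end_gf u := gf (fun w => (king_end w)%:R * u ^+ singles w).
Definition occs_gf u := gf (fun w => (king_word w)%:R * u ^+ occs w).

(** A king word ending with its maximum is [a (+) 1] with [king_end a]; its last letter is one more
    singleton component, whence the factor [u t]. *)
Lemma singles_gf_end u :
  singles_gf u = (1 + fpsC u * fpsX T) * singles_end_gf u.
Proof.
rewrite mulrDl mul1r -mulrA -gf_conv_r -gfZ -gfD; apply: eq_gf => -[|n] w pw.
  move: pw; rewrite perm_words0 inE => /eqP ->.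
  by rewrite /conv big_ord0 mulr0 addr0.
rewrite (conv_nil_r _ pw).
case: eqP => [E | /eqP E]; last first.
  by rewrite (king_end_last pw E) mul0r mulr0 addr0.
have sw := size_perm_word pw.
have Ew : w = rcons (take n w) n.
  by rewrite -{2}E -take_nth ?sw // take_oversize ?sw.
have pt : take n w \in perm_words n.
  case/perm_wordP: pw => _ uw aw; apply/perm_wordP; split.
  - by rewrite size_takel ?sw.
  - exact: take_uniq.
  move: uw aw; rewrite Ew rcons_uniq all_rcons => /andP[nin _] /andP[_ /allP aw].
  rewrite -cats1 take_size_cat ?size_takel ?sw //.
  apply/allP => x xt; have := aw x xt; rewrite ltnS leq_eqVlt => /orP[/eqP xn|//].
  by move: nin; rewrite -{1}xn xt.
have Eg : w = glue (take n w) [::] by rewrite /glue (size_perm_word pt) cats1.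
have -> : king_end w = false.
  by rewrite Ew -{2}(size_perm_word pt) king_end_max.
rewrite mul0r add0r mul1r.
have -> : king_word w = king_end (take n w) by rewrite {1}Eg king_glue andbT.
have -> : singles w = (singles (take n w)).+1.
  rewrite -[RHS]addn1 {1}/singles sw -addn1 iotaD count_cat add0n.
  rewrite {1}Eg (count_single_glue _ pt).
  congr (_ + _)%N; rewrite /= addn0 {1}Eg -[X in single _ X](size_perm_word pt).
  by rewrite (single_glue_mid _ pt).
by rewrite exprS; ring.
Qed.

Lemma king_gf_start : king_gf = (1 + fpsX T) * king_start_gf.
Proof.
rewrite mulrDl mul1r -gf_conv_l -gfD; apply: eq_gf => -[|n] w pw.
  move: pw; rewrite perm_words0 inE => /eqP ->.
  by rewrite /conv big_ord0 addr0.
rewrite (conv_nil_l _ pw); case: eqP => [E | /eqP E]; last first.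
  by rewrite king_start_head // mul0r addr0.
have s0 := single_head0 pw E (ltn0Sn n).
have [_ _ Ew] := single_decomp pw (ltn0Sn n) s0.
rewrite mul1r {1}Ew king_glue take0.
move: (size_perm_word pw); case: w E {pw s0 Ew} => [|x w] //= -> _.
by rewrite king_start_0 add0r.
Qed.

(** Each index satisfying [p] contributes one factor [u], so its term is the difference of two
    successive powers. With [p = single w] the sum marks one singleton component and gives weight
    [u] only to those on its left. *)
Lemma telescope_count u (p : pred nat) n :
  \sum_(i < n | p i) (u - 1) * u ^+ count p (iota 0 i)
  = u ^+ count p (iota 0 n) - 1.
Proof.
elim: n => [|n IHn]; first by rewrite big_ord0 subrr.
have -> : iota 0 n.+1 = iota 0 n ++ [:: n] by rewrite -addn1 iotaD.
rewrite big_mkcond big_ord_recr -big_mkcond /= IHn count_cat /= addn0.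
by case: (p n); rewrite ?addn0 ?addn1 ?exprS; ring.
Qed.

(** The word is cut at the marked component: those to its left are the singleton components of the
    left summand, and the right summand carries no power of [u]. *)
Lemma singles_gf_king u :
  singles_gf u = king_gf
    + fpsC (u - 1) * (fpsX T * (singles_end_gf u * king_start_gf)).
Proof.
rewrite -gf_conv -gfZ -gfD; apply: eq_gf => n w pw.
rewrite {1}/singles -[in u ^+ _](subrK 1 (u ^+ _)) -telescope_count /conv.
rewrite mulrDr mulr1 addrC; congr (_ + _).
rewrite !mulr_sumr; apply: eq_bigr => i si.
have li : (i < n)%N by rewrite -(size_perm_word pw).
have [pa _ Ew] := single_decomp pw li si.
have -> : king_word w = king_end (take i w) && king_start (tail_word i w).
  by rewrite {1}Ew king_glue.
rewrite -mulnb natrM -(count_single_glue (tail_word i w) pa) -Ew.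
by ring.
Qed.

(** At most one selected exponent is nonzero, so a power of the sum becomes a sum with at most one
    nonzero term. *)
Lemma expr_sum_unique u n (p : pred nat) (c : nat -> nat) :
  (forall i j, (i < n)%N -> (j < n)%N -> p i -> p j -> (0 < c i)%N ->
     (0 < c j)%N -> i = j) ->
  u ^+ (\sum_(i < n | p i) c i)%N - 1 = \sum_(i < n | p i) (u ^+ c i - 1).
Proof.
elim: n => [|n IHn] H; first by rewrite !big_ord0 subrr.
rewrite [in LHS]big_mkcond [in RHS]big_mkcond !big_ord_recr -!big_mkcond /=.
have {}IHn := IHn (fun i j li lj => H i j (ltnW li) (ltnW lj)).
case pn: (p n); last by rewrite addn0 addr0.
case: (posnP (c n)) => [->|cn]; first by rewrite addn0 subrr addr0.
rewrite big1 ?big1 ?add0n ?add0r // => i pi.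
  have /eqP -> : c i == 0%N; last by rewrite subrr.
  rewrite -leqn0 leqNgt; apply/negP => ci.
  have := H i n (ltnW (ltn_ord i)) (ltnSn n) pi pn ci cn.
  by move=> E; have := ltn_ord i; rewrite E ltnn.
apply/eqP; rewrite -leqn0 leqNgt; apply/negP => ci.
have := H i n (ltnW (ltn_ord i)) (ltnSn n) pi pn ci cn.
by move=> E; have := ltn_ord i; rewrite E ltnn.
Qed.

End GeneratingFunctions.

(** * Occurrences of the pattern in words *)

Lemma drop_tail_word n w i : w \in perm_words n -> (i < n)%N -> single w i ->
  drop i.+1 w = shift i.+1 (tail_word i w).
Proof.
move=> pw li si; have [pa _ Ew] := single_decomp pw li si.
by rewrite {1}Ew -{1}(size_perm_word pa) drop_glue (size_perm_word pa).
Qed.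

Lemma singles_rev_tail n w i : w \in perm_words n -> (i < n)%N -> single w i ->
  singles (rev (drop i.+1 w)) = singles (rev (tail_word i w)).
Proof.
move=> pw li si; rewrite (drop_tail_word pw li si) /shift -map_rev.
exact: singles_shift.
Qed.

Lemma perm_words1 w : (w \in perm_words 1) = (w == [:: 0%N]).
Proof. by rewrite /perm_words /= inE. Qed.

Lemma singles_gt0 w : (0 < singles w)%N ->
  exists2 l, (l < size w)%N & single w l.
Proof.
by rewrite -has_count => /hasP[l]; rewrite mem_iota => /andP[_ ll] sl; exists l.
Qed.

Lemma single_singles_rev w k : (k < size w)%N -> single w k ->
  (0 < singles (rev w))%N -> size w = 1%N.
Proof.
move=> lk sk /singles_gt0[l]; rewrite size_rev => ll sl.
exact: single_rev_unique lk ll sk sl.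
Qed.

(** A word starting with 0 has a singleton direct component; having a singleton skew component as
    well would force it to be [[:: 0]]. *)
Lemma king_start_singles n w : w \in perm_words n -> w != [:: 0%N] ->
  (0 < singles (rev w))%N -> king_start w = king_word w.
Proof.
move=> pw w0 sw; apply: king_start_head; apply/eqP => h0.
have n0 : (0 < n)%N.
  by move: sw; rewrite -(size_perm_word pw); case: (w).
have := single_singles_rev _ (single_head0 pw h0 n0) sw.
rewrite (size_perm_word pw) => /(_ n0) n1; move: pw.
by rewrite n1 perm_words1 (negbTE w0).
Qed.

Lemma single_drop w i k : (k < size w)%N -> (i < k)%N -> single w k ->
  single (drop i.+1 w) (k - i.+1).
Proof.
move=> lk ik /singleP-/(_ lk) H.
apply/singleP => [|m]; rewrite size_drop; first by lia.
move=> lm; rewrite !nth_drop.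
have -> : (i.+1 + (k - i.+1))%N = k by lia.
have lt : (i.+1 + m < size w)%N by lia.
by have [lo hi] := H _ lt; split=> ?; [apply: lo | apply: hi]; lia.
Qed.

(** The component at [k] remains a singleton direct component of the suffix, which by assumption
    also has a singleton skew component. *)
Lemma single_singles_last w i k : (i < k)%N -> (k < size w)%N -> single w k ->
  (0 < singles (rev (drop i.+1 w)))%N -> size (drop i.+1 w) = 1%N.
Proof.
move=> ik lk sk; apply: (@single_singles_rev _ (k - i.+1)).
  by rewrite size_drop; lia.
exact: single_drop.
Qed.

Lemma occsE w : occs w =
  (\sum_(i < size w | single w i) singles (rev (drop i.+1 w)))%N.
Proof.
rewrite /occs sumnE big_map big_filter -{1}[size w]subn0 -/(index_iota 0 _).
by rewrite big_mkord.
Qed.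

Section Occurrences.
Variables (T : comUnitRingType) (u : T).

(* The weight of the last summand [r] in [s = a (+) 1 (+) r]; [r = 1] is excluded
   because [a (+) 1 (+) 1] is not king. *)
Definition skew_weight w : T :=
  (king_word w)%:R * u ^+ singles (rev w) + (- 1 * (king_word w)%:R
  + (1 - u) * (w == [:: 0%N])%:R).

(** The word [[:: 0]] has one singleton component, so its contribution [u - 1] is cancelled by the
    correction term [1 - u]. *)
Lemma skew_weight0 : skew_weight [:: 0%N] = 0.
Proof. by rewrite /skew_weight /=; ring. Qed.

Lemma skew_weightE w : w != [:: 0%N] ->
  skew_weight w = (king_word w)%:R * (u ^+ singles (rev w) - 1).
Proof. by move=> /negbTE w0; rewrite /skew_weight w0 mulr0 addr0; ring. Qed.

Lemma occs_conv n w : w \in perm_words n ->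
  (king_word w)%:R * u ^+ occs w =
  (king_word w)%:R + conv (fun v => (king_end v)%:R) skew_weight w.
Proof.
move=> pw; apply/eqP; rewrite addrC -subr_eq; apply/eqP.
rewrite -{2}[(king_word w)%:R]mulr1 -mulrBr occsE /conv (size_perm_word pw).
have dec i : (i < n)%N -> single w i ->
    tail_word i w \in perm_words (n - i.+1) /\
    king_word w = king_end (take i w) && king_start (tail_word i w).
  move=> li si; have [_ pb Ew] := single_decomp pw li si.
  by split=> //; rewrite {1}Ew king_glue.
(* For a word that is not king every term of [conv] must vanish: a nonzero [skew_weight] makes
   [king_start] and [king_word] agree on the tail, and the product of the indicators is then that of
   [king_word w]. *)
case kw: (king_word w); last first.
  rewrite mul0r big1 // => i si.
  have [pt] := dec i (ltn_ord i) si; rewrite kw.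
  have [->|t0] := eqVneq (tail_word i w) [:: 0%N].
    by rewrite skew_weight0 mulr0.
  rewrite skew_weightE //; have [->|s0] := posnP (singles (rev (tail_word i w))).
    by rewrite subrr !mulr0.
  rewrite (king_start_singles pt t0 s0) mulrA -natrM mulnb => <-.
  by rewrite mul0r.
have tail_neq i : (i < n)%N -> single w i -> tail_word i w != [:: 0%N].
  move=> li si; apply/eqP => t0; have [_] := dec i li si.
  by rewrite kw t0 andbF.
rewrite mul1r (expr_sum_unique _ (p := single w)
  (c := fun i => singles (rev (drop i.+1 w)))) => [|i j li lj si sj ci cj].
  apply: eq_bigr => i si; have li := ltn_ord i.
  rewrite (singles_rev_tail pw li si) skew_weightE ?tail_neq //.
  have [_] := dec i li si; rewrite kw => /esym/andP[-> /king_start_tail ->].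
  by rewrite !mul1r.
(* If the earlier of two components contributed, its tail would be [[:: 0]], which a king word does
   not allow. *)
have absurd a b : (a < b)%N -> (a < n)%N -> (b < n)%N -> single w a ->
    single w b -> (0 < singles (rev (drop a.+1 w)))%N -> False.
  move=> ab la lb sa sb /(single_singles_last ab _ sb).
  rewrite (size_perm_word pw) size_drop (size_perm_word pw) => /(_ lb) n1.
  have [pt _] := dec a la sa; move: pt (tail_neq a la sa).
  by rewrite n1 perm_words1 => ->.
case: (ltngtP i j) => // ij.
  by case: (absurd i j ij).
by case: (absurd j i ij).
Qed.

Lemma fpsCB (a b : T) : fpsC (a - b) = fpsC a - fpsC b.
Proof. by apply: fpsP => n /=; case: eqP => _ //; rewrite subrr. Qed.

Lemma fpsC1 : fpsC 1 = 1 :> fps T.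
Proof. by []. Qed.

Lemma singles_gf1 : singles_gf (1 : T) = king_gf T.
Proof. by apply: eq_gf => n w _; rewrite expr1n mulr1. Qed.

Lemma occs_gf_king : occs_gf u = king_gf T + fpsX T * (singles_end_gf 1 *
  (singles_gf u - king_gf T + (1 - fpsC u) * fpsX T)).
Proof.
have -> : singles_gf u - king_gf T + (1 - fpsC u) * fpsX T = gf skew_weight.
  rewrite /skew_weight gfD gfD !gfZ gf_word0 -addrA fpsCB fpsC1; congr (_ + _).
    (* Reversal preserves king words and exchanges direct and skew components. *)
    rewrite -[LHS]gf_rev; apply: eq_gf => n w _.
    by rewrite king_rev.
  congr (_ + _); rewrite -[X in fpsC X](sub0r 1) fpsCB fpsC1 -mulN1r.
  by congr (_ * _); rewrite -[LHS]sub0r.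
have -> : singles_end_gf 1 = gf (fun v => (king_end v)%:R) :> fps T.
  by apply: eq_gf => n w _; rewrite expr1n mulr1.
by rewrite -gf_conv -gfD; apply: eq_gf => n w; apply: occs_conv.
Qed.

Lemma fps_unitE (h : fps T) : (h \is a GRing.unit) = (fcoef h 0 \is a GRing.unit).
Proof. by []. Qed.

(** The equations of the overview are solved first for [F - A], then for [E]; the denominators have
    constant coefficient 1 and are therefore units. *)
Lemma occs_gfE (t := fpsX T) (U := fpsC u) (A := king_gf T) :
  occs_gf u = (1 + t ^+ 2 * (1 - U) / (1 + t)
              * (1 - A ^+ 2 / (1 + t * (1 + U + U * t + (1 - U) * A)))) * A.
Proof.
set D := 1 + t * _.
have Ut : 1 + t \is a GRing.unit by rewrite fps_unitE /= addr0 unitr1.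
have UD : D \is a GRing.unit.
  by rewrite fps_unitE fcoefD fcoefXM /= addr0 unitr1.
have AB : A = (1 + t) * singles_end_gf 1.
  by rewrite -[in 1 + t](mul1r t) -fpsC1 -singles_gf_end singles_gf1.
have AS := king_gf_start T; rewrite -/A -/t in AS.
have FG := singles_gf_end u; rewrite -/U -/t in FG.
have FA := singles_gf_king u; rewrite fpsCB fpsC1 -/U -/t -/A in FA.
(* Here [D = (1 + t)(1 + U t) + (1 - U) t A]. The first summand turns [F - A = (U - 1) t G S] into
   [(U - 1) t F A], and the terms in [F] cancel. *)
have DF : D * (singles_gf u - A) = - ((1 - U) * t * A ^+ 2).
  have -> : D * (singles_gf u - A) = (1 + t) * (1 + U * t) * (singles_gf u - A)
      + (1 - U) * t * A * (singles_gf u - A) by rewrite /D; ring.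
  have -> : (1 + t) * (1 + U * t) * (singles_gf u - A) = 
      (U - 1) * t * ((1 + U * t) * singles_end_gf u)
              * ((1 + t) * king_start_gf T) by rewrite FA; ring.
  by rewrite -FG -AS; ring.
have {}DF : singles_gf u - A = - ((1 - U) * t * A ^+ 2) / D.
  by rewrite -DF mulrC mulKr.
have BA : singles_end_gf 1 = A / (1 + t) by rewrite AB mulrC mulKr.
rewrite occs_gf_king -/t -/U -/A DF BA.
by ring.
Qed.

End Occurrences.

(** * Permutations as words *)

Lemma far_dist (a b : nat) : far a b = (1 < `|b - a|)%N.
Proof. by rewrite /far; lia. Qed.

Section PermWord.
Variable n : nat.
Implicit Types (s : 'S_n) (i j m : 'I_n).

Definition word s : seq nat := [seq val (s i) | i <- enum 'I_n].

Lemma size_word s : size (word s) = n.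
Proof. by rewrite size_map size_enum_ord. Qed.

Lemma nth_word s i : nth 0%N (word s) i = s i.
Proof. by rewrite (nth_map i) ?size_enum_ord // nth_ord_enum. Qed.

Lemma word_inj : injective word.
Proof.
by move=> s s' E; apply/permP => i; apply: val_inj; rewrite /= -!nth_word E.
Qed.

Lemma word_perm s : word s \in perm_words n.
Proof.
apply/perm_wordP; split; first exact: size_word.
  by rewrite map_inj_uniq ?enum_uniq // => i j /val_inj/perm_inj.
by apply/allP => _ /mapP[i _ ->]; apply: ltn_ord.
Qed.

Lemma sum_words (V : nmodType) (f : seq nat -> V) :
  \sum_(s : 'S_n) f (word s) = \sum_(w <- perm_words n) f w.
Proof.
rewrite -(big_map word xpredT f); apply: perm_big.
have uw : uniq (map word (index_enum {perm 'I_n})).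
  by rewrite (map_inj_uniq word_inj) index_enum_uniq.
apply: uniq_perm; rewrite ?permutations_uniq //.
apply: (uniq_min_size uw _ _).2; first by move=> _ /mapP[s _ ->]; apply: word_perm.
rewrite size_permutations ?iota_uniq // size_iota size_map.
by rewrite -[index_enum _]enumT -cardE card_Sn.
Qed.

Lemma king_wordE s : (s \in king n) = king_word (word s).
Proof.
rewrite inE; apply/idP/(sortedP 0%N) => [/forallP ks k | ks].
  rewrite size_word => lk; have lk' := ltnW lk.
  have := forallP (ks (Ordinal lk')) (Ordinal lk); rewrite /= eqxx /=.
  rewrite -[k]/(val (Ordinal lk')) -[(val _).+1]/(val (Ordinal lk)) !nth_word.
  by rewrite far_dist.
apply/forallP => i; apply/forallP => j; apply/implyP => /eqP ij.
have := ks i; rewrite size_word -ij ltn_ord => /(_ isT).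
by rewrite !nth_word far_dist.
Qed.

(** Boxes (0,1) and (0,2) put everything left of [i] below [s i]; (1,0) and (2,0) put everything to
    its right above [s i]. Given this, (1,1) puts the entries between the two positions above [s j],
    and (2,2) puts those after [j] below it. *)
Lemma mesh12_occP s i j :
  reflect [/\ (i < j)%N, single (word s) i,
             forall m, (i < m < j)%N -> (s j < s m)%N
           & forall m, (j < m)%N -> (s m < s j)%N]
    ((i, j) \in mesh12_occ pat s).
Proof.
have iw : (i < size (word s))%N by rewrite size_word.
rewrite inE /=; apply: (iffP and3P) => [[ij sij /forallP box] | [ij si mid rgt]].
  have avoid a b (la : (a < 3)%N) (lb : (b < 3)%N) m :
      (a, b) \in [:: (0, 1); (0, 2); (1, 0); (1, 1); (2, 0); (2, 2)]%N ->
      ~~ in_box s i j (Ordinal la, Ordinal lb) m.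
    move=> ab; have /implyP := box (Ordinal la, Ordinal lb).
    rewrite inE /= => /(_ ab); rewrite negb_exists => /forallP; exact.
  (* The boxes are open, so equal values must be excluded separately. *)
  have neq m (k : 'I_n) : m != k :> nat -> s m != s k :> nat.
    by move=> mk; apply: contra mk => /eqP/val_inj/perm_inj ->.
  have far_m m : [/\ (m < i -> s m < s i)%N, (i < m -> s i < s m)%N,
     (i < m < j -> s j < s m)%N & (j < m -> s m < s j)%N].
    move: (avoid 0%N 1%N isT isT m isT) (avoid 0%N 2 isT isT m isT)
      (avoid 1%N 0%N isT isT m isT) (avoid 1%N 1%N isT isT m isT)
      (avoid 2 0%N isT isT m isT) (avoid 2 2 isT isT m isT).
    rewrite /in_box /=; have := neq m i; have := neq m j.
    have := ltn_ord (s m); have := ltn_ord m; rewrite !ltnS.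
    have [/val_inj->|mj] := eqVneq (m : nat) j; first by split; lia.
    by move: sij ij mj => {avoid box neq}; split; lia.
  split=> //; try by move=> m; have [] := far_m m.
  apply/singleP => // m; rewrite size_word => lm.
  by rewrite -[m]/(val (Ordinal lm)) !nth_word; have [] := far_m (Ordinal lm).
have {}si m : (m < i -> s m < s i)%N /\ (i < m -> s i < s m)%N.
  have/singleP-/(_ iw m) := si; rewrite size_word ltn_ord !nth_word; exact.
split=> //; first exact: (si j).2.
apply/forallP => -[a b]; apply/implyP; rewrite inE /= => ab.
rewrite negb_exists; apply/forallP => m; apply/negP.
have := si m; have := mid m; have := rgt m; have := (si j).2 ij.
move: ab; rewrite !inE !xpair_eqE /in_box /=.
by case/or4P=> [||| /or3P[]] /andP[/eqP-> /eqP->] /=; lia.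
Qed.

(** The suffix reaches the end of the word, so the position [rev_ord l] of [s] is position [l] of
    the reversed suffix. The conditions on the entries after and before it become the two halves of
    [single]. *)
Lemma mesh12_occ_rev s i (l : 'I_n) :
  ((i, rev_ord l) \in mesh12_occ pat s) =
  single (word s) i && ((l < n - i.+1)%N && single (rev (drop i.+1 (word s))) l).
Proof.
set v := drop i.+1 (word s).
have sv : size (rev v) = (n - i.+1)%N by rewrite size_rev size_drop size_word.
have nv k (lk : (k < n)%N) : (k < n - i.+1)%N ->
    nth 0%N (rev v) k = s (rev_ord (Ordinal lk)).
  move=> lk'; rewrite nth_rev -size_rev sv // nth_drop -nth_word /=.
  by congr nth; lia.
apply/mesh12_occP/andP => [[ij si mid rgt] | [si /andP[ll]]].
  have ll : (l < n - i.+1)%N by move: ij => /=; have := ltn_ord l; lia.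
  split=> //; apply/andP; split=> //; apply/singleP; rewrite sv // => k lk'.
  have lk : (k < n)%N by lia.
  rewrite (nv k lk lk') (nv l (ltn_ord l) ll).
  have -> : Ordinal (ltn_ord l) = l by exact: val_inj.
  by split=> kl; [apply: rgt | apply: mid] => /=; have := ltn_ord l; lia.
move/singleP; rewrite sv => /(_ ll) H.
have Hm m : (i < m)%N -> ((l < rev_ord m)%N -> (s (rev_ord l) < s m)%N) /\
    ((rev_ord m < l)%N -> (s m < s (rev_ord l))%N).
  move=> im; have lm' : (rev_ord m < n - i.+1)%N by move=> /=; have := ltn_ord m; lia.
  have := H _ lm'; rewrite (nv _ (ltn_ord _) lm') (nv l (ltn_ord l) ll).
  have -> : Ordinal (ltn_ord l) = l by exact: val_inj.
  have -> : Ordinal (ltn_ord (rev_ord m)) = rev_ord m by exact: val_inj.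
  by rewrite rev_ordK => -[].
split=> //=; first by have := ltn_ord l; lia.
  by move=> m /andP[im ml]; apply: (Hm m im).1 => /=; have := ltn_ord m; lia.
by move=> m ml; apply: (Hm m _).2 => /=; have := ltn_ord m; lia.
Qed.

Lemma mesh12_countE s : mesh12_count pat s = occs (word s).
Proof.
rewrite occsE size_word /mesh12_count -sum1_card big_mkcond /=.
transitivity (\sum_(p : 'I_n * 'I_n) ((p.1, p.2) \in mesh12_occ pat s))%N.
  by apply: eq_bigr => -[i j] _ /=; case: (_ \in _).
rewrite -(pair_bigA _ (fun i j => ((i, j) \in mesh12_occ pat s : nat))) /=.
rewrite [RHS]big_mkcond; apply: eq_bigr => i _.
rewrite (reindex_inj rev_ord_inj) /=.
under eq_bigr do rewrite mesh12_occ_rev.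
case: ifP => _ /=; last by rewrite big1.
rewrite /singles size_rev size_drop size_word -sum1_count.
rewrite -{2}[(n - _)%N]subn0 -/(index_iota 0 _) big_mkord.
rewrite (big_ord_widen_cond n (fun k => single _ k) (fun=> 1%N)) ?leq_subr //.
rewrite [RHS]big_mkcond; apply: eq_bigr => l _.
by rewrite andbC; case: (_ && _).
Qed.

End PermWord.

(** * Transfer of the three generating functions to words *)

Lemma sum_king n (V : pzSemiRingType) (f : seq nat -> V) :
  \sum_(s in king n) f (word s) = \sum_(w <- perm_words n) (king_word w)%:R * f w.
Proof.
rewrite -(sum_words n (fun w => (king_word w)%:R * f w)) big_mkcond.
apply: eq_bigr => s _; rewrite king_wordE.
by case: king_word; rewrite ?mul1r ?mul0r.
Qed.

Lemma kingAE (T : comUnitRingType) : kingA T = king_gf T.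
Proof.
apply: fpsP => n /=; rewrite -sum1_card natr_sum (sum_king n (fun=> 1)).
by apply: eq_bigr => w _; rewrite mulr1.
Qed.

Lemma distE_occs : distE pat = occs_gf 'X.
Proof.
apply: fpsP => n /=; rewrite -(sum_king n (fun w => 'X^(occs w))).
by apply: eq_bigr => s _; rewrite mesh12_countE.
Qed.

(** Since [0 ^+ 0 = 1], setting [u = 0] keeps exactly the permutations without an occurrence. *)
Lemma avoidP_occs : avoidP pat = occs_gf 0.
Proof.
apply: fpsP => n /=; rewrite -(sum_king n (fun w => 0 ^+ occs w)).
rewrite -sum1_card natr_sum big_mkcond [RHS]big_mkcond /=.
apply: eq_bigr => s _; rewrite inE mesh12_countE expr0n.
by case: (s \in king n); case: eqP.
Qed.

(* King words of length [k] with distinct letters below [n], built by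
   backtracking so that few candidates are generated. *)
Fixpoint king_words n k : seq (seq nat) :=
  if k is k'.+1 then
    [seq x :: w | w <- king_words n k',
                  x <- [seq x <- iota 0 n | (x \notin w) && path far x w]]
  else [:: [::]].

Lemma mem_king_words n k w : (w \in king_words n k) =
  [&& size w == k, uniq w, all (fun x => x < n)%N w & king_word w].
Proof.
elim: k w => [|k IHk] [|x w] //=; last rewrite eqSS.
  by apply/negP => /allpairsPdep[? [? []]].
apply/allpairsPdep/and4P => [[v [y [vk]]] | [sw /andP[xw uw] /andP[xn aw] pw]].
  rewrite mem_filter mem_iota IHk in vk * => /andP[/andP[yv py] yn] [-> ->].
  by move: vk yn => /and4P[-> -> -> _]; rewrite yv add0n => /andP[_ ->]; split.
exists w, x; split=> //; first by rewrite IHk sw uw aw /king_word (path_sorted pw).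
by rewrite mem_filter mem_iota xw pw xn.
Qed.

Lemma king_words_uniq n k : uniq (king_words n k).
Proof.
elim: k => //= k IHk; apply: allpairs_uniq_dep => // [w _|].
  by rewrite filter_uniq // iota_uniq.
by move=> [w x] [w' x'] _ _ /= [-> ->].
Qed.

Lemma king_words_perm n :
  perm_eq [seq w <- perm_words n | king_word w] (king_words n n).
Proof.
apply: uniq_perm; rewrite ?king_words_uniq ?filter_uniq ?permutations_uniq //.
move=> w; rewrite mem_filter mem_king_words; apply/andP/and4P.
  by case=> -> /perm_wordP[-> -> ->].
by case=> /eqP sw uw aw ->; split=> //; apply/perm_wordP.
Qed.

Lemma sum_count_exp (T : pzSemiRingType) (x : T) (m : nat) (l : seq nat) :
  all (fun c => c < m)%N l ->
  \sum_(c <- l) x ^+ c = \sum_(k < m) (count_mem (k : nat) l)%:R * x ^+ k.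
Proof.
elim: l => [|c l IHl] /=.
  by rewrite big_nil big1 // => k _; rewrite mul0r.
case/andP=> lc /IHl IH; rewrite big_cons IH.
under [RHS]eq_bigr do rewrite natrD mulrDl.
rewrite big_split /=; congr (_ + _).
rewrite (bigD1 (Ordinal lc)) //= eqxx mul1r big1 ?addr0 // => k.
by rewrite -val_eqE /= eq_sym => /negbTE ->; rewrite mul0r.
Qed.

(** The premise is a boolean about lists of natural numbers, so evaluating it involves no polynomial
    arithmetic. *)
Lemma distE_coef n (c0 c1 c2 : nat) (l := map occs (king_words n n)) :
  [&& all (fun c => c < 3)%N l, count_mem 0%N l == c0, count_mem 1%N l == c1
    & count_mem 2 l == c2] ->
  fcoef (distE pat) n = c0%:R + c1%:R * 'X + c2%:R * 'X^2.
Proof.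
move=> /and4P[l3 /eqP<- /eqP<- /eqP<-]; rewrite distE_occs /=.
transitivity (\sum_(c <- l) 'X^c : {poly int}).
  rewrite big_map -(perm_big _ (king_words_perm n)) /= big_filter [RHS]big_mkcond.
  by apply: eq_bigr => w _; case: king_word; rewrite ?mul1r ?mul0r.
by rewrite (sum_count_exp _ l3) !big_ord_recr big_ord0 /= add0r mulr1.
Qed.

Theorem theorem4p3 :
  [/\ (let t := fpsX int in
       let A := kingA int in
       avoidP pat
       = (t + 1 / (1 + t)
          - t ^+ 2 * A ^+ 2 / ((1 + t) * (1 + t + t * A))) * A),
      (let t := fpsX {poly int} in
       let u := fpsC ('X : {poly int}) in
       let A := kingA {poly int} in
       distE pat
       = (1 + t ^+ 2 * (1 - u) / (1 + t)
              * (1 - A ^+ 2 / (1 + t * (1 + u + u * t + (1 - u) * A)))) * A)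
    & [seq fcoef (distE pat) n | n <- iota 0 9]
      = [:: 1; 1; 0; 0; 2; 14; 86 + 4 * 'X; 624 + 20 * 'X + 2 * 'X^2;
            5096 + 136 * 'X + 10 * 'X^2]].
Proof.
split; [cbv zeta | cbv zeta | rewrite /iota /map].
- rewrite avoidP_occs kingAE occs_gfE.
  have Ut : 1 + fpsX int \is a GRing.unit by rewrite fps_unitE /= addr0 unitr1.
  have -> : fpsC 0 = 0 :> fps int by [].
  rewrite !mul0r !addr0 !subr0 !mul1r !mulr1; congr (_ * _).
  set t := fpsX int in Ut *; set A := king_gf int.
  have -> : 1 + t * (1 + A) = 1 + t + t * A by ring.
  have UD : 1 + t + t * A \is a GRing.unit.
    by rewrite fps_unitE fcoefD fcoefXM /= !addr0 unitr1.
  rewrite invrM //; apply: subr0_eq.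
  (* What remains is [1 + t^2 / (1 + t) = t + 1 / (1 + t)]; the two sides differ by this product,
     which is zero because [1 + t] is a unit. *)
  transitivity ((1 - t) * (1 - (1 + t) / (1 + t))); first by ring.
  by rewrite divrr // subrr mulr0.
- by rewrite distE_occs kingAE occs_gfE.
rewrite (distE_coef (n := 0) (c0 := 1) (c1 := 0) (c2 := 0)); last by vm_compute.
rewrite (distE_coef (n := 1) (c0 := 1) (c1 := 0) (c2 := 0)); last by vm_compute.
rewrite (distE_coef (n := 2) (c0 := 0) (c1 := 0) (c2 := 0)); last by vm_compute.
rewrite (distE_coef (n := 3) (c0 := 0) (c1 := 0) (c2 := 0)); last by vm_compute.
rewrite (distE_coef (n := 4) (c0 := 2) (c1 := 0) (c2 := 0)); last by vm_compute.
rewrite (distE_coef (n := 5) (c0 := 14) (c1 := 0) (c2 := 0)); last by vm_compute.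
rewrite (distE_coef (n := 6) (c0 := 86) (c1 := 4) (c2 := 0)); last by vm_compute.
rewrite (distE_coef (n := 7) (c0 := 624) (c1 := 20) (c2 := 2)); last by vm_compute.
rewrite (distE_coef (n := 8) (c0 := 5096) (c1 := 136) (c2 := 10)); last by vm_compute.
by rewrite !mul0r !addr0.
Qed.
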